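(* For every finite simple graph $G$ (with at least one vertex), $\mathrm{Z}_{(1)}(G)\le 2\,\mathrm{Z}_{(0)}(G)$. In particular, if $B$ is a zero forcing set of $G$ and $R(B)$ is a reversal of $B$ (that is, $R(B)=R_F(B)$ for some set of forces $F$ of $B$ in $G$), then $B\cup R(B)$ is a $1$-leaky forcing set of $G$.
   Context: Zero forcing color change rule: a blue vertex $u$ may force (color blue) a white vertex $v$ if $v$ is the only white neighbor of $u$; this force is denoted $u\to v$. A leak is a vertex that is not allowed to perform a force. For $\ell\in\{0,1\}$, a set $B\subseteq V(G)$ is an $\ell$-leaky forcing set of $G$ if, for every set $L\subseteq V(G)$ with $|L|=\ell$, starting with exactly $B$ blue (all others white) and iteratively applying the color change rule, with vertices of $L$ not allowed to force, eventually colors all of $V(G)$ blue. A zero forcing set is a $0$-leaky forcing set. $\mathrm{Z}_{(\ell)}(G)$ is the minimum size of an $\ell$-leaky forcing set of $G$. A set of forces $F$ of $B$ in $G$ is a set of forces admitting a chronological ordering such that, starting with exactly $B$ blue, each force is valid when performed (it colors a vertex that is white at that time) and at the end all of $V(G)$ is blue. The reversal of $B$ given $F$ is $R_F(B)=\{v\in V(G): v\to y\notin F \text{ for all } y\in V(G)\}$, the set of vertices that perform no force in $F$. *)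

(* Defs.v *)
From mathcomp Require Import all_boot.

Set Implicit Arguments.
Unset Strict Implicit.
Unset Printing Implicit Defensive.

Section LeakyForcing.

Variables (T : finType) (e : rel T).
Implicit Types (L S B : {set T}) (u v : T) (F : {set T * T}).

(* S is the set of blue vertices and L the set of leaks. *)
Definition can_force L S u v : bool :=
  [&& u \notin L, u \in S & [set w | e u w & w \notin S] == [set v]].

Definition force_step L S S' : bool :=
  [exists u, exists v, can_force L S u v && (S' == v |: S)].

(* A force that is available stays available until its target is blue, so
   reaching setT by some sequence of forces is the same as reaching it by every
   sequence that is continued until no force is possible. *)
Definition leaky_forcing (l : nat) B : bool :=
  [forall L : {set T}, (#|L| == l) ==> connect (force_step L) B [set: T]].

Definition zero_forcing B : bool := leaky_forcing 0 B.

(* The default [set: T] always satisfies the condition (leaky_forcingT), so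
   this is a true minimum; see leaky_numberP. *)
Definition leaky_number (l : nat) : nat :=
  #|[arg min_(B < [set: T] | leaky_forcing l B) #|B|]|.

Fixpoint chronological S (fs : seq (T * T)) : bool :=
  if fs is (u, v) :: fs' then can_force set0 S u v && chronological (v |: S) fs'
  else S == [set: T].

Definition set_of_forces B F : Prop :=
  exists2 fs : seq (T * T), chronological B fs & F = [set:: fs].

Definition reversal F : {set T} := [set v | [forall y, (v, y) \notin F]].

Lemma leaky_forcingT l : leaky_forcing l [set: T].
Proof. by apply/forallP=> L; apply/implyP=> _; apply: connect0. Qed.

Lemma leaky_numberP l :
  (exists2 B, leaky_forcing l B & #|B| = leaky_number l) /\
  (forall B, leaky_forcing l B -> leaky_number l <= #|B|).
Proof.
rewrite /leaky_number; case: arg_minnP => [|B hB minB].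
  exact: leaky_forcingT.
by split; [exists B | exact: minB].
Qed.

End LeakyForcing.

(* Main.v *)
(** Let x be the leak and let u_1 -> w_1, ..., u_k -> w_k be the forces in order.
    If x forces nothing, the given forces still work.  If x = u_i, perform the forces before the i-th one as given, and the forces
    after it backwards, w_k -> u_k, ..., w_(i+1) -> u_(i+1), which needs only
    vertices other than x because x is blue before step i.  A vertex that is
    still white at step i forces after step i or never, so it has been coloured
    backwards or lies in the reversal.  For the bound, a vertex forces at most
    once, hence the reversal of B is not larger than B. *)

Require Import Defs.
From mathcomp Require Import all_boot.

Set Implicit Arguments.
Unset Strict Implicit.
Unset Printing Implicit Defensive.

Section Reversal.

Variables (T : finType) (e : rel T).
Implicit Types (L S B C : {set T}) (u v w x z : T) (fs : seq (T * T)).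

Lemma can_forceP L S u v :
  reflect [/\ u \notin L, u \in S, e u v, v \notin S &
              forall w, e u w -> w != v -> w \in S]
          (can_force e L S u v).
Proof.
apply: (iffP and3P) => [[uL uS /eqP/setP N] | [uL uS euv vS N]].
  have /[!inE]/[!eqxx]/andP[euv vS] := N v; split=> // w euw wv.
  by have /[!inE] := N w; rewrite euw (negbTE wv) => /negbFE.
split=> //; apply/eqP/setP=> w; rewrite !inE.
have [->|wv] := eqVneq w v; first by rewrite euv vS.
by apply/negP=> /andP[/N/(_ wv) ->].
Qed.

(** If [v] is blue already, the force is skipped; so forces can be replayed from a larger blue
    set. *)
Lemma connect_force L C D u v :
  u \notin L -> u \in C -> e u v -> (forall w, e u w -> w != v -> w \in C) ->
  connect (force_step e L) (v |: C) D -> connect (force_step e L) C D.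
Proof.
move=> uL uC euv N; have [vC|vC] := boolP (v \in C).
  by rewrite (setUidPr _) // sub1set.
apply: connect_trans; apply/connect1/existsP; exists u; apply/existsP; exists v.
by rewrite eqxx andbT; apply/can_forceP.
Qed.

Lemma chronological_of_connect S :
  connect (force_step e set0) S [set: T] -> exists fs, chronological e S fs.
Proof.
case/connectP=> p; elim: p S => [|S' p IH] S /=.
  by move=> _ <-; exists [::] => /=.
case/andP=> /existsP[u /existsP[v /andP[uv /eqP->]]] /IH{}IH /IH[fs fsP].
by exists ((u, v) :: fs); rewrite /= uv.
Qed.

(** Blue sets only grow, so the target of a later force of [u] is white already in [S]. *)
Lemma chronological_source_neighbor S fs u :
  chronological e S fs -> u \in unzip1 fs -> exists2 w, e u w & w \notin S.
Proof.
elim: fs S => //= -[a b] fs IH S /= /andP[/can_forceP[_ _ eab bS _] fsP].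
rewrite inE => /predU1P[->|/(IH _ fsP)[w euw]]; first by exists b.
by rewrite !inE negb_or => /andP[_ wS]; exists w.
Qed.

(** Right after [u] forces, all its neighbours are blue, so it cannot force again. *)
Lemma chronological_uniq_sources S fs :
  chronological e S fs -> uniq (unzip1 fs).
Proof.
elim: fs S => //= -[u v] fs IH S /= /andP[/can_forceP[_ _ _ _ N] fsP].
rewrite (IH _ fsP) andbT; apply/negP=> /(chronological_source_neighbor fsP)[w euw].
by rewrite !inE negb_or => /andP[wv]; rewrite (N w).
Qed.

Lemma chronological_size S fs :
  chronological e S fs -> #|S| + size fs = #|T|.
Proof.
elim: fs S => [|[u v] fs IH] S /=; first by move/eqP->; rewrite addn0 cardsT.
by case/andP=> /can_forceP[_ _ _ vS _] /IH <-; rewrite cardsU1 vS addnS.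
Qed.

Lemma mem_reversal fs z : (z \in reversal [set:: fs]) = (z \notin unzip1 fs).
Proof.
rewrite inE; apply/forallP/idP => [zF|zfs y].
  by apply/mapP=> -[[a b] ab zE]; have := zF b; rewrite inE zE ab.
by rewrite inE; apply: contra zfs => /(map_f fst).
Qed.

(** Both sides are [#|T|] minus the number of forces: each force colours one new vertex and has its
    own source. *)
Lemma card_reversal S fs :
  chronological e S fs -> #|reversal [set:: fs]| = #|S|.
Proof.
move=> fsP; apply: (@addIn (size fs)); rewrite (chronological_size fsP).
have <- : #|unzip1 fs| = size fs.
  by rewrite (card_uniqP (chronological_uniq_sources fsP)) size_map.
rewrite -(cardC (mem (unzip1 fs))) addnC; congr (_ + _).
by apply: eq_card => z; rewrite mem_reversal.
Qed.

Hypothesis e_sym : symmetric e.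

(* The third case of the disjunction holds for the sources of the forces that
   precede fs; it is what makes the induction on fs, whose first force is
   reversed last, go through. *)
Lemma connect_backward L S C D fs :
  chronological e S fs -> L \subset S ->
  (forall z, [\/ z \in C, z \in unzip1 fs |
              z \in S /\ forall w, e z w -> w \in S]) ->
  connect (force_step e L) (C :|: [set z in unzip1 fs]) D ->
  connect (force_step e L) C D.
Proof.
elim: fs S => [|[u v] fs IH] S /=.
  by move=> _ _ _; rewrite set_nil setU0.
case/andP=> /can_forceP[_ uS euv vS N] fsP LS cover CD.
have vu : v != u by apply: contraNneq vS => ->.
apply: (IH _ fsP) => [|z|]; first exact: subset_trans LS (subsetUr _ _).
  have [?|/[!in_cons]/predU1P[->|?]|[zS Nz]] := cover z.
  - exact: Or31.
  (* All neighbours of [u] lie in [v |: S], so [u] passes to the third case. *)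
  - apply: Or33; split=> [|w euw]; rewrite !inE ?uS ?orbT //.
    by have [//|wv] := eqVneq w v; rewrite (N w).
  - exact: Or32.
  - apply: Or33; split=> [|w ezw]; rewrite !inE ?zS ?orbT //.
    by rewrite (Nz w) ?orbT.
(* The reversed force: [v] is no leak, being outside [S]. *)
apply: (@connect_force _ _ _ v u); last by rewrite setUCA -set_cons.
- by apply: contra vS => /(subsetP LS).
- have [vC|/[!in_cons]/predU1P[vuE|vfs]|[vS' _]] := cover v.
  + by rewrite !inE vC.
  + by rewrite vuE eqxx in vu.
  + by rewrite !inE vfs orbT.
  + by rewrite vS' in vS.
- by rewrite e_sym.
(* In the third case the neighbour [v] of [z] would lie in [S]. *)
move=> z evz zu; have [zC|/[!in_cons]/predU1P[zuE|zfs]|[_ /(_ v)]] := cover z.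
- by rewrite !inE zC.
- by rewrite zuE eqxx in zu.
- by rewrite !inE zfs orbT.
- by rewrite e_sym evz (negbTE vS) => /(_ isT).
Qed.

(** [S] follows the given forces, while [C] also holds the vertices that force nothing from now
    on. *)
Lemma connect_one_leak x S C fs :
  chronological e S fs -> S \subset C ->
  (forall z, z \notin unzip1 fs -> z \in C) ->
  connect (force_step e [set x]) C [set: T].
Proof.
elim: fs S C => [|[u v] fs IH] S C /=.
  by move=> _ _ CT; rewrite (_ : C = [set: T]) //; apply/setP=> z; rewrite CT ?inE.
case/andP=> /can_forceP[_ uS euv vS N] fsP /subsetP SC CR.
have cover z : z \notin unzip1 fs -> z \in C.
  by move=> zfs; have [->|zu] := eqVneq z u; [exact: SC | rewrite CR // inE negb_or zu].
have [ux|ux] := eqVneq u x.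
  (* The force of the leak is skipped; if [v] is white in [C], it is a source in [fs] and is
     coloured backwards. *)
  apply: (connect_backward fsP) => [|z|].
  - by rewrite sub1set -ux inE uS orbT.
  - by have [?|/cover ?] := boolP (z \in unzip1 fs); [apply: Or32 | apply: Or31].
  - rewrite (_ : _ :|: _ = [set: T]) //; apply/setP=> z; rewrite !inE.
    by have [|/cover->] := boolP (z \in unzip1 fs); rewrite ?orbT.
apply: (@connect_force _ _ _ u v); rewrite ?inE ?SC //.
  by move=> w euw wv; rewrite SC ?N.
apply: (IH _ _ fsP) => [|z /cover zC]; last by rewrite inE zC orbT.
by apply: setUS; apply/subsetP.
Qed.

Lemma leaky_forcing_reversal B fs :
  chronological e B fs -> leaky_forcing e 1 (B :|: reversal [set:: fs]).
Proof.
move=> fsP; apply/forallP=> L; apply/implyP=> /cards1P[x ->].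
apply: (connect_one_leak _ fsP) => [|z zfs]; first exact: subsetUl.
by rewrite inE mem_reversal zfs orbT.
Qed.

End Reversal.

Theorem corollary2p7 (T : finType) (e : rel T)
    (e_sym : symmetric e) (e_irr : irreflexive e) (T_gt0 : 0 < #|T|) :
  leaky_number e 1 <= 2 * leaky_number e 0 /\
  (forall (B : {set T}) (F : {set T * T}),
     zero_forcing e B -> set_of_forces e B F ->
     leaky_forcing e 1 (B :|: reversal F)).
Proof.
split=> [|B F _ [fs fsP ->]]; last exact: leaky_forcing_reversal.
have [[B /forallP/(_ set0) + <-] _] := leaky_numberP e 0.
rewrite cards0 eqxx => /chronological_of_connect[fs fsP].
have [_ min1] := leaky_numberP e 1.
apply: leq_trans (min1 _ (leaky_forcing_reversal e_sym fsP)) _.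
by rewrite mul2n -addnn -{2}(card_reversal fsP) cardsU leq_subr.
Qed.
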